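(* Let $\delta_0 \approx 2.338$ be the smallest real root of the function $\delta \mapsto \mathrm{Ai}(-\delta)$. For every integer $n \ge 1$ and every $\delta \in (-\infty, \delta_0)$, the Hankel determinant $h_n = h_n(\delta)$ satisfies $h_n \neq 0$.
   Context: $\mathrm{Ai}$ is the classical Airy function. Let $\Gamma$ be any contour in the complex plane going from $\infty \times e^{5i\pi/6}$ to $\infty \times e^{i\pi/6}$ (for instance the concatenation of the straight half-line from $\infty \times e^{5i\pi/6}$ to $0$ with the straight half-line from $0$ to $\infty\times e^{i\pi/6}$; the integrals below do not depend on the choice). For $\delta\in\mathbb{R}$ and integers $k \ge 0$ define the moments $$\mu_k = \mu_k(\delta) = \int_\Gamma z^k e^{i\left(\frac{z^3}{3} - \delta z\right)}\, dz .$$ For an integer $m\ge 1$ define the Hankel determinant $$h_m = h_m(\delta) = \det\left[\mu_{j+k-2}\right]_{j,k=1,\ldots,m}.$$ *)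

(* Defs.v *)
From mathcomp Require Import all_boot all_order all_algebra.
From mathcomp Require Import all_classical all_reals all_analysis.
From mathcomp Require Import complex.

Set Implicit Arguments.
Unset Strict Implicit.
Unset Printing Implicit Defensive.

Import Order.TTheory GRing.Theory Num.Theory.
Import numFieldNormedType.Exports.

Local Open Scope classical_set_scope.
Local Open Scope ring_scope.
Local Open Scope complex_scope.

(* The classical Airy function of a real argument, by Airy's improper
   (conditionally convergent) integral
     Ai(x) = 1/pi * int_0^oo cos (t^3/3 + x t) dt. *)
Definition Ai (R : realType) (x : R) : R :=
  pi^-1 * lim ((fun T : R => \int[lebesgue_measure]_(t in `[0, T])
                               cos (t ^+ 3 / 3 + x * t)) @ +oo).

Definition cexp (R : realType) (z : R[i]) : R[i] :=
  (expR (complex.Re z) * cos (complex.Im z))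
    +i* (expR (complex.Re z) * sin (complex.Im z)).

Definition cintegral (R : realType) (D : set R) (g : R -> R[i]) : R[i] :=
  (\int[lebesgue_measure]_(t in D) complex.Re (g t))
    +i* (\int[lebesgue_measure]_(t in D) complex.Im (g t)).

(* Integral of [f] along the half-line t |-> t e^(i theta), t from 0 to oo. *)
Definition ray_integral (R : realType) (theta : R) (f : R[i] -> R[i]) : R[i] :=
  let u := cexp ('i%C * theta%:C) in
  cintegral `[0, +oo[ (fun t : R => f (t%:C * u) * u).

(* Gamma comes in from oo e^(5 i pi / 6) to 0, hence the minus sign, and goes
   out from 0 to oo e^(i pi / 6).  On both half-lines i z^3 / 3 = - t^3 / 3, so
   the integrals defining the moments converge absolutely. *)
Definition Gamma_integral (R : realType) (f : R[i] -> R[i]) : R[i] :=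
  ray_integral (pi / 6) f - ray_integral (5 * pi / 6) f.

Definition moment (R : realType) (k : nat) (delta : R) : R[i] :=
  Gamma_integral
    (fun z : R[i] => z ^+ k * cexp ('i%C * (z ^+ 3 / 3 - delta%:C * z))).

(* Indices start at 0 here, so mu_(j+k-2) reads mu_(j+k). *)
Definition hankel (R : realType) (m : nat) (delta : R) : R[i] :=
  \det (\matrix_(j < m, k < m) moment (j + k) delta).

Definition is_smallest_root (R : realType) (f : R -> R) (x : R) : Prop :=
  f x = 0 /\ forall y : R, f y = 0 -> x <= y.

(* Main.v *)
(** Rotating the contour turns the moments into [mu_k = i^k m_k] with
    [m_k' = m_{k+1}], [m_0'' = - delta m_0] and [m_0(delta) = 2 pi Ai(- delta)].
    With [x = - delta], let [h_n] be the squared norms and [u_n], [v_n] the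
    recurrence coefficients of the orthogonal polynomials of the moment functional,
    so that the Hankel determinant is [h_0 ... h_{n-1}] and [h_n = h_0 u_1 ... u_n].
    They obey the Toda equations [v_n' = u_{n+1} - u_n],
    [u_n' = u_n (v_n - v_{n-1})] and the string equations
    [v_n^2 + u_n + u_{n+1} = x], [u_n (v_n + v_{n-1}) = n].
    Hence [(u_{n+1} h_n^2)' = (n + 1) h_n^2 > 0]: if [u_{n+1}] were [>= 0] at a
    point to the right of the largest zero of [Ai], it would stay positive, which is
    incompatible with [v_n < 0] near [+oo].  So every [u_n] is negative there, and
    no [h_n] vanishes.  That [v_{n+1} < 0] near [+oo] follows from a Riccati
    blow-up argument, starting from the boundedness of [Ai] on the right. *)
Require Import Defs.
From mathcomp Require Import all_boot all_order all_algebra.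
From mathcomp Require Import all_classical all_reals all_analysis.
From mathcomp Require Import complex.
From mathcomp Require Import measurable_realfun ring lra zify.

Set Implicit Arguments.
Unset Strict Implicit.
Unset Printing Implicit Defensive.

Import Order.TTheory GRing.Theory Num.Theory.
Import numFieldNormedType.Exports.

Local Open Scope classical_set_scope.
Local Open Scope ring_scope.

(** * Derivatives and the Toda recurrence *)

Section Derivatives.
Context {R : realType}.
Implicit Types f g : R -> R.

Lemma derD f g (x df dg : R) : is_derive x 1 f df -> is_derive x 1 g dg ->
  is_derive x 1 (fun t => f t + g t) (df + dg).
Proof. by move=> Hf Hg; exact: is_deriveD. Qed.

Lemma derN f (x df : R) : is_derive x 1 f df -> is_derive x 1 (fun t => - f t) (- df).
Proof. by move=> Hf; exact: is_deriveN. Qed.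

Lemma derM f g (x df dg : R) : is_derive x 1 f df -> is_derive x 1 g dg ->
  is_derive x 1 (fun t => f t * g t) (f x * dg + g x * df).
Proof. by move=> Hf Hg; exact: is_deriveM. Qed.

Lemma derV f (x df : R) : f x != 0 -> is_derive x 1 f df ->
  is_derive x 1 (fun t => (f t)^-1) (- df / f x ^+ 2).
Proof.
move=> f0 Hf; apply: (is_derive_eq (is_deriveV f0 Hf)).
by rewrite /GRing.scale/= mulNr mulrC mulNr.
Qed.

Lemma derC (c x : R) : is_derive x 1 (fun=> c) 0.
Proof. exact: is_derive_cst. Qed.

Lemma derI (x : R) : is_derive x 1 (fun t => t) 1.
Proof. exact: is_derive_id. Qed.

Lemma derE f (x d d' : R) : is_derive x 1 f d -> d = d' -> is_derive x 1 f d'.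
Proof. by move=> H <-. Qed.

Lemma der_within f (df : R -> R) (a b : R) :
  (forall x, a <= x <= b -> is_derive x 1 f (df x)) ->
  {within `[a, b], continuous f}.
Proof.
move=> Hf; apply: derivable_within_continuous => x.
by rewrite in_itv/= => /Hf [].
Qed.

Lemma slope_ge f (df : R -> R) (a b c : R) : a <= b ->
  (forall x, a <= x <= b -> is_derive x 1 f (df x)) ->
  (forall x, a <= x <= b -> c <= df x) -> c * (b - a) <= f b - f a.
Proof.
move=> ab Hf Hc.
have [|z zab ->] := @MVT_segment _ f df a b ab _ (der_within Hf).
  by move=> x; rewrite in_itv/= => /andP[/ltW ax /ltW xb]; apply: Hf; rewrite ax.
by rewrite ler_wpM2r ?subr_ge0// Hc// -in_itv.
Qed.

Lemma slope_gt0 f (df : R -> R) (a b : R) : a < b ->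
  (forall x, a <= x <= b -> is_derive x 1 f (df x)) ->
  (forall x, a <= x <= b -> 0 < df x) -> f a < f b.
Proof.
move=> ab Hf Hc.
have [|z zab E] := @MVT _ f df a b ab _ (der_within Hf).
  by move=> x; rewrite in_itv/= => /andP[/ltW ax /ltW xb]; apply: Hf; rewrite ax.
rewrite -subr_gt0 E mulr_gt0 ?subr_gt0// Hc//.
by move: zab; rewrite in_itv/= => /andP[/ltW-> /ltW->].
Qed.

Lemma slope_unbounded f (df : R -> R) (a c : R) : 0 < c ->
  (forall x, a < x -> is_derive x 1 f (df x)) ->
  (forall x, a < x -> c <= df x) ->
  forall M, exists2 X, a < X & forall x, X < x -> M < f x.
Proof.
move=> c0 Hf Hc M.
(* The base point is [a + 1] because nothing is assumed at [a] itself; from there, slope at least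
   [c] gains [M - f (a + 1)] within a length [|(M - f (a + 1)) / c|]. *)
pose X := a + 1 + `|(M - f (a + 1)) / c|.
exists X; first by rewrite /X; have := normr_ge0 ((M - f (a + 1)) / c); lra.
move=> x Xx; have N0 := normr_ge0 ((M - f (a + 1)) / c).
have ax : a + 1 <= x by rewrite /X in Xx; lra.
have : c * (x - (a + 1)) <= f x - f (a + 1).
  apply: (@slope_ge f df) => // z /andP[az _]; [apply: Hf|apply: Hc]; lra.
suff : M - f (a + 1) < c * (x - (a + 1)) by lra.
rewrite mulrC -ltr_pdivrMr//.
by apply: le_lt_trans (ler_norm _) _; rewrite /X in Xx; lra.
Qed.

(* [1 / f] decreases at rate at least [c]. *)
Lemma riccati_blowup f (df : R -> R) (a c : R) : 0 < c ->
  (forall x, a < x -> is_derive x 1 f (df x)) ->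
  (forall x, a < x -> 0 < f x) ->
  (forall x, a < x -> c * f x ^+ 2 <= df x) -> False.
Proof.
move=> c0 Hf f0 Hc.
have [|x ax|X aX /(_ (X + 1))] :=
    @slope_unbounded (fun t => - (f t)^-1) (fun t => df t / f t ^+ 2) a c c0 _ _ 0.
- move=> x ax; apply: derE; first by apply/derN/derV/Hf => //; rewrite gt_eqF// f0.
  by rewrite mulNr opprK.
- by rewrite ler_pdivlMr ?Hc// exprn_gt0// f0.
have := f0 (X + 1); rewrite -invr_gt0; lra.
Qed.

End Derivatives.

(** * The induction step from index [n] to [n + 1] *)

Section Step.
Context {R : realType}.

(* The system satisfied by [u_n], [v_n], [h_n] once [u_{n+1}] and [v_{n-1}] are
   eliminated by the string equations. *)
Definition airy_state (a : R) (n : nat) (u v h : R -> R) : Prop :=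
  [/\ forall x, a < x -> h x != 0 /\ u x <= 0,
      forall x, a < x -> is_derive x 1 u (2 * u x * v x - n%:R),
      forall x, a < x -> is_derive x 1 v (x - 2 * u x - v x ^+ 2),
      forall x, a < x -> is_derive x 1 h (v x * h x) &
      exists2 X, a < X & forall x, X < x -> v x < 0 /\ - n%:R <= u x].

Variables (a : R) (n : nat) (u v h : R -> R).
Hypothesis S : airy_state a n u v h.

(** This is u_{n+1}, read off from v_n^2 + u_n + u_{n+1} = x. *)
Let W x := x - v x ^+ 2 - u x.

Lemma state_next_derive x : a < x ->
  is_derive x 1 W (n.+1%:R - 2 * W x * v x).
Proof.
case: S => _ Hu Hv _ _ ax; have Dv := Hv _ ax.
apply: (derE (derD (derD (derI x) (derN (derM Dv Dv))) (derN (Hu _ ax)))).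
rewrite /W -natr1; ring.
Qed.

(** A value [W x >= 0] starts a chain: [W h^2] has derivative [(n + 1) h^2], so [W] is positive
    afterwards; once [v < 0], [W' >= n + 1] makes [W] unbounded; then [v' = W - u >= W] drives [v]
    above 0, against its eventual sign. *)
Lemma state_next_neg x : a < x -> W x < 0.
Proof.
case: S => Hhu Hu Hv Hh [X aX HX] ax; rewrite ltNge; apply/negP => Wx.
have Wpos z : x < z -> 0 < W z.
  move=> xz.
  have : W x * h x ^+ 2 < W z * h z ^+ 2.
    apply: (@slope_gt0 _ (fun t => W t * h t ^+ 2) (fun t => n.+1%:R * h t ^+ 2)) => //.
      move=> t /andP[xt _]; have at_ : a < t by lra.
      apply: (derE (derM (state_next_derive at_) (derM (Hh _ at_) (Hh _ at_)))).
      by rewrite -natr1; ring.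
    move=> t /andP[xt _]; rewrite mulr_gt0// ?ltr0n//.
    by rewrite exprn_even_gt0//= (Hhu t _).1//; lra.
  move=> /(le_lt_trans _) => /(_ 0); rewrite mulr_ge0 ?sqr_ge0// => /(_ isT).
  by rewrite pmulr_lgt0// exprn_even_gt0//= (Hhu z _).1//; lra.
pose Y := Num.max x X.
have Yx z : Y < z -> x < z /\ X < z.
  by rewrite /Y gt_max => /andP[].
have n1 : (1 : R) <= n.+1%:R by rewrite ler1n.
have [||Z YZ WZ] := @slope_unbounded _ W (fun t => n.+1%:R - 2 * W t * v t) Y 1 ltr01 _ _ 1.
- by move=> t /Yx[xt Xt]; apply: state_next_derive; lra.
- move=> t /Yx[xt Xt]; have := Wpos _ xt; have [+ _] := HX _ Xt; nra.
have [||Z' ZZ' vZ] := @slope_unbounded _ v (fun t => t - 2 * u t - v t ^+ 2) Z 1 ltr01 _ _ 0.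
- by move=> t Zt; apply: Hv; have [] := Yx t _; lra.
- move=> t Zt; have := WZ _ Zt; rewrite /W.
  have [] := Hhu t; last lra.
  by have [] := Yx t _; lra.
have := vZ (Z' + 1); have [|+ _] := HX (Z' + 1); last lra.
have [] := Yx (Z' + 1) _; lra.
Qed.

(** This is v_{n+1}, read off from u_{n+1} (v_{n+1} + v_n) = n + 1. *)
Let V x := n.+1%:R / W x - v x.

Lemma state_next_derive_v x : a < x -> is_derive x 1 V (x - 2 * W x - V x ^+ 2).
Proof.
move=> ax; have W0 : W x != 0 by rewrite lt_eqF// state_next_neg.
case: S => _ Hu Hv _ _.
apply: (derE (derD (derM (derC _ _) (derV W0 (state_next_derive ax))) (derN (Hv _ ax)))).
have -> : u x = x - v x ^+ 2 - W x by rewrite /W; ring.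
rewrite /V; field.
exact: W0.
Qed.

(** If [V] is nonnegative at arbitrarily large points, it is positive from some point on. Then
    [W v = n + 1 - W V >= n + 1], which sends [W] to minus infinity faster than linearly enough for
    [v^2 = x - u - W] to dominate the equation of [v]; [- v] then satisfies a Riccati inequality and
    blows up. *)
Lemma state_next_v_neg : exists2 X, a < X & forall x, X < x -> V x < 0.
Proof.
have VW x : a < x -> W x * (V x + v x) = n.+1%:R.
  move=> ax; have W0 : W x != 0 by rewrite lt_eqF// state_next_neg.
  by rewrite /V; field.
case: S => Hhu Hu Hv Hh [X aX HX].
(* This is h_{n+1}, whose logarithmic derivative is [V]. *)
pose g x := W x * h x.
have g0 x : a < x -> g x != 0.
  by move=> ax; rewrite mulf_neq0 ?(Hhu x _).1// lt_eqF// state_next_neg.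
have Hg x : a < x -> is_derive x 1 g (V x * g x).
  move=> ax; apply: (derE (derM (state_next_derive ax) (Hh _ ax))).
  rewrite -(VW _ ax) /g; ring.
apply: contrapT => /forall2NP noX.
(* Beyond 4, [W < 0] and [u <= 0] force [v^2 > 4]; this gives [v < - 2] below. *)
pose Y := Num.max X 4.
have Yx z : Y < z -> X < z /\ 4 < z by rewrite /Y gt_max => /andP[].
have [x0 /not_implyP[Yx0 /negP]] : exists x0, ~ (Y < x0 -> V x0 < 0).
  have [|/existsNP//] := noX Y.
  by rewrite /Y lt_max aX.
rewrite -leNgt => V0.
have {noX}Vpos x : x0 < x -> 0 < V x.
  move=> xx.
  (* The derivative of [V g^2] is [(x - 2 W + V^2) g^2], positive because [W < 0 < x]. *)
  suff : V x0 * g x0 ^+ 2 < V x * g x ^+ 2.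
    move=> /(le_lt_trans _) => /(_ 0); rewrite mulr_ge0 ?sqr_ge0// => /(_ isT).
    by rewrite pmulr_lgt0// exprn_even_gt0//= g0//; have := Yx _ Yx0; lra.
  apply: (@slope_gt0 _ (fun t => V t * g t ^+ 2)
    (fun t => (t - 2 * W t + V t ^+ 2) * g t ^+ 2)) => // t /andP[xt _].
    have at_ : a < t by have := Yx _ Yx0; lra.
    apply: (derE (derM (state_next_derive_v at_) (derM (Hg _ at_) (Hg _ at_)))).
    by cbv beta; ring.
  have [Xx0 x04] := Yx _ Yx0.
  rewrite mulr_gt0// ?exprn_even_gt0//= ?g0//; last lra.
  have := @state_next_neg t; have := sqr_ge0 (V t); lra.
have facts x : x0 < x -> [/\ a < x, 4 < x, v x < 0, - n%:R <= u x <= 0 & W x < 0].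
  move=> xx; have [Xx0 x04] := Yx _ Yx0.
  have ax : a < x by lra.
  have [|v0 un] := HX x; first lra.
  split=> //; [lra|by rewrite un (Hhu x ax).2|exact: state_next_neg].
have n1 : (1 : R) <= n.+1%:R by rewrite ler1n.
have Wv x : x0 < x -> n.+1%:R <= W x * v x.
  move=> xx; have [ax _ _ _ W0] := facts x xx.
  have := VW _ ax; have := Vpos _ xx; nra.
have vlt x : x0 < x -> v x < - 2.
  move=> xx; have [ax x4 v0 /andP[_ u0] W0] := facts x xx.
  rewrite ltNge; apply/negP => v2; have : W x = x - v x ^+ 2 - u x by [].
  nra.
have HW x : x0 < x -> is_derive x 1 (fun t => - W t) (2 * W x * v x - n.+1%:R).
  move=> xx; have [ax _ _ _ _] := facts x xx.
  by apply: (derE (derN (state_next_derive ax))); rewrite opprB.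
have [|X1 xX1 W1] := slope_unbounded ltr01 HW _ 1.
  by move=> x /Wv; lra.
(* From [- W > 1] and [v < - 2] one has [W v > 2]; with [W v >= n + 1] the derivative
   [2 W v - (n + 1) - 1] is at least [W v - 1 > 1]. So eventually [- W > x + 2 n]. *)
have [||X2 X12 W2] := @slope_unbounded _ (fun t => - W t - t)
    (fun x => 2 * W x * v x - n.+1%:R - 1) X1 1 ltr01 _ _ (2 * n%:R).
- by move=> x Xx; apply: derD (HW _ _) (derN (derI x)); lra.
- move=> x Xx; have := W1 _ Xx; have xx : x0 < x by lra.
  have := Wv _ xx; have := vlt _ xx; nra.
(* Now [v^2 = x - u - W > 2 x + 2 n - u], and [- n <= u <= 0] gives [x - 2 u <= 3/4 v^2], which
   leaves [(- v)' >= v^2 / 4]. *)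
apply: (@riccati_blowup _ (fun t => - v t) (fun x => - (x - 2 * u x - v x ^+ 2)) X2 4^-1).
- by rewrite invr_gt0 ltr0n.
- by move=> x Xx; apply/derN/Hv; have [] := facts x _; lra.
- by move=> x Xx; have [] := facts x _; lra.
- move=> x Xx; have [|ax x4 v0 /andP[un u0] W0] := facts x; first lra.
  have := W2 _ Xx; have EW : W x = x - v x ^+ 2 - u x by [].
  have := ler0n R n.
  lra.
Qed.

Lemma airy_state_next : airy_state a n.+1 W V (fun x => W x * h x).
Proof.
have [X aX HX] := state_next_v_neg.
have VW x : a < x -> W x * (V x + v x) = n.+1%:R.
  move=> ax; have W0 : W x != 0 by rewrite lt_eqF// state_next_neg.
  by rewrite /V; field.
have [Hhu Hu Hv Hh [X' aX' HX']] := S; split=> [x ax|x ax|x ax|x ax|].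
- split; last exact/ltW/state_next_neg.
  by rewrite mulf_neq0 ?(Hhu x _).1// lt_eqF// state_next_neg.
- apply: (derE (state_next_derive ax)).
  by rewrite -(VW _ ax); ring.
- exact: state_next_derive_v.
- apply: (derE (derM (state_next_derive ax) (Hh _ ax))).
  by rewrite -(VW _ ax); ring.
exists (Num.max (Num.max X X') 1); first by rewrite !lt_max aX.
move=> x; rewrite !gt_max => /andP[/andP[Xx X'x] x1].
have ax : a < x by lra.
have v0 := (HX' _ X'x).1; have V0 := HX _ Xx; have W0 := state_next_neg ax.
split=> //; have := VW _ ax.
have EW : W x = x - v x ^+ 2 - u x by [].
have u0 := (Hhu x ax).2.
(* As [x > 1], a value of [v] in []-1, 0[] would make [W = x - v^2 - u] positive. With [v <= -1] and
   [V < 0], the relation [W (V + v) = n + 1] bounds [W] below by [- (n + 1)]. *)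
have : v x <= -1 by rewrite leNgt; apply/negP => ?; nra.
nra.
Qed.

End Step.

(** * Hankel determinants of a Toda flow *)

Section JacobiMoments.
Context {K : comPzRingType}.
Variables (u v h : nat -> K).

(* The coefficient of [P_j] in [X^k], where the monic polynomials [P_j] satisfy
   [X P_j = P_{j+1} + v_j P_j + u_j P_{j-1}]. *)
Fixpoint jacobi_coef (k j : nat) : K :=
  if k is k'.+1 then
    (if j is j'.+1 then jacobi_coef k' j' else 0) + v j * jacobi_coef k' j
      + u j.+1 * jacobi_coef k' j.+1
  else (j == 0%N)%:R.

Lemma jacobi_coef_gt k j : (k < j)%N -> jacobi_coef k j = 0.
Proof.
elim: k j => [|k IH] [|j] //= kj.
by rewrite !IH ?(mulr0, addr0)//; lia.
Qed.

Lemma jacobi_coef_diag k : jacobi_coef k k = 1.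
Proof. by elim: k => //= k ->; rewrite !jacobi_coef_gt ?(mulr0, addr0)//; lia. Qed.

Hypothesis hu : forall l, h l.+1 = u l.+1 * h l.

(** The inner product of X^i and X^k, the P_l being orthogonal with squared norms h_l, truncated to
    [l < N]. *)
Let S N i k := \sum_(l < N) jacobi_coef i l * jacobi_coef k l * h l.

(** Multiplication by X is self-adjoint: [h l.+1 = u l.+1 * h l] exchanges the raising and lowering
    terms of the recurrence, and the diagonal terms are symmetric. The bounds on [i] and [k] make
    the boundary terms of the truncation vanish. *)
Lemma jacobi_gram_shift N i k : (i < N)%N -> (k < N)%N ->
  S N i.+1 k = S N i k.+1.
Proof.
have shiftE p q : (q < N)%N -> (0 < N)%N ->
    \sum_(l < N) (if l : nat is l'.+1 then jacobi_coef p l' else 0) *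
      jacobi_coef q l * h l =
    \sum_(l < N) u l.+1 * jacobi_coef p l * jacobi_coef q l.+1 * h l.
  case: N => // N qN _; rewrite big_ord_recl/= !mul0r add0r big_ord_recr/=.
  rewrite (@jacobi_coef_gt q)// mulr0 mul0r addr0; apply: eq_bigr => l _.
  by rewrite /bump/= add1n hu; ring.
move=> iN kN; have N0 : (0 < N)%N by apply: leq_ltn_trans iN.
transitivity (\sum_(l < N) (if l : nat is l'.+1 then jacobi_coef i l' else 0) *
      jacobi_coef k l * h l +
    \sum_(l < N) v l * jacobi_coef i l * jacobi_coef k l * h l +
    \sum_(l < N) u l.+1 * jacobi_coef i l.+1 * jacobi_coef k l * h l).
  by rewrite -!big_split; apply: eq_bigr => -[[|l] lN] _ /=; ring.
rewrite shiftE//.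
transitivity (\sum_(l < N) (if l : nat is l'.+1 then jacobi_coef k l' else 0) *
      jacobi_coef i l * h l +
    \sum_(l < N) v l * jacobi_coef i l * jacobi_coef k l * h l +
    \sum_(l < N) u l.+1 * jacobi_coef i l * jacobi_coef k l.+1 * h l).
  rewrite shiftE// [RHS]addrC [X in _ = _ + X]addrC addrA; congr (_ + _ + _).
  by apply: eq_bigr => l _; ring.
by rewrite -!big_split; apply: eq_bigr => -[[|l] lN] _ /=; ring.
Qed.

(** Shifting moves all powers to one side, where only [l = 0] contributes to X^0. The sum is first
    widened to [N = n + k + 1], which adds only zero terms since [j < n], so that every shift stays
    in range. *)
Lemma jacobi_gram n j k : (j < n)%N ->
  S n j k = jacobi_coef (j + k) 0 * h 0%N.
Proof.
move=> jn; pose N := (n + k).+1.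
have SN : S n j k = S N j k.
  rewrite /S (big_ord_widen_cond N xpredT
    (fun l => jacobi_coef j l * jacobi_coef k l * h l)); last by rewrite /N; lia.
  rewrite [RHS](bigID (fun l : 'I_N => l < n)%N)/= [X in _ = _ + X]big1 ?addr0//.
  by move=> l ln; rewrite jacobi_coef_gt ?mul0r//; lia.
have jkN : (j + k < N)%N by rewrite /N; lia.
rewrite SN; move: N jkN {SN jn} => N; elim: j k => [|j IH] k jkN.
  case: N jkN => // N _; rewrite /S (bigD1 ord0)//= big1 ?addr0 ?mul1r// => l.
  by rewrite -val_eqE/= => /negPf ->; rewrite !mul0r.
by rewrite jacobi_gram_shift ?IH ?addnS//; lia.
Qed.

Lemma hankel_jacobi n :
  \det (\matrix_(j < n, k < n) (jacobi_coef (j + k) 0 * h 0%N)) = \prod_(l < n) h l.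
Proof.
(* The Hankel matrix factors as B D B^T, with B lower unitriangular and D the diagonal of the
   [h l]. *)
pose B := \matrix_(j < n, l < n) jacobi_coef j l.
have detB : \det B = 1.
  rewrite det_trig; first by apply: big1 => i _; rewrite mxE jacobi_coef_diag.
  by apply/is_trig_mxP => i j ij; rewrite mxE jacobi_coef_gt.
transitivity (\det (B *m diag_mx (\row_l h l) *m B^T)); last first.
  rewrite !det_mulmx det_tr detB mul1r mulr1 det_diag.
  by apply: eq_bigr => l _; rewrite mxE.
congr (\det _); apply/matrixP => j k; rewrite !mxE -(@jacobi_gram n)//.
by apply: eq_bigr => l _; rewrite mul_mx_diag !mxE; ring.
Qed.

End JacobiMoments.

(** * Moments along the Toda flow *)

Section Toda.
Context {R : realType}.
Variables (a : R) (u v : nat -> R -> R).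
Hypothesis u0 : forall x, a < x -> u 0%N x = 0.
Hypothesis du : forall n x, a < x ->
  is_derive x 1 (u n.+1) (u n.+1 x * (v n.+1 x - v n x)).
Hypothesis dv : forall n x, a < x -> is_derive x 1 (v n) (u n.+1 x - u n x).

Local Notation B k j := (fun x => jacobi_coef (u^~ x) (v^~ x) k j).

(** Under the Toda flow P_j' = - u_j P_{j-1}; differentiating the expansion of the constant X^k in
    the P_j gives this formula. The proof is a direct induction, with [u 0 = 0] covering the missing
    index below 0. *)
Lemma derive_jacobi_coef k j x : a < x ->
  is_derive x 1 (B k j) (u j.+1 x * B k j.+1 x).
Proof.
move=> ax; elim: k j => [|k IH] j /=.
  by rewrite mulr0; exact: derC.
have D : is_derive x 1 (fun x => if j is j'.+1 then B k j' x else 0) (u j x * B k j x).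
  by case: j => [|j]; [rewrite u0// mul0r; exact: derC|exact: IH].
apply: (derE (derD (derD D (derM (dv j ax) (IH j))) (derM (du j ax) (IH j.+1)))).
by cbv beta; ring.
Qed.

Variables (y : nat -> R -> R).
Hypothesis dy : forall k x, a < x -> is_derive x 1 (y k) (y k.+1 x).
Hypothesis y1 : forall x, a < x -> y 1%N x = v 0%N x * y 0%N x.

Lemma derivatives_jacobi k x : a < x -> y k x = B k 0 x * y 0%N x.
Proof.
elim: k x => [|k IH] x ax; first by rewrite mul1r.
(* The induction hypothesis holds only to the right of [a], but that is a neighbourhood of [x],
   which suffices to differentiate it. *)
have E : \near x, B k 0 x * y 0%N x = y k x.
  by near=> z; rewrite IH//; near: z; exact: lt_nbhsr.
have D := near_eq_is_derive E (derM (derive_jacobi_coef k 0 ax) (dy 0%N ax)).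
rewrite -(derive_val (is_derive := dy k ax)) (derive_val (is_derive := D)) y1//=.
ring.
Unshelve. all: by end_near. Qed.

End Toda.

(** * The recurrence started from a bounded solution of the Airy equation *)

Section AiryHankel.
Context {R : realType}.

(** The pair (u_n, v_n), generated by the string equations alone from u_0 = 0 and v_0 = w; the Toda
    equations are derived afterwards. *)
Fixpoint airy_uv (w : R -> R) (n : nat) : (R -> R) * (R -> R) :=
  if n is m.+1 then
    let u := (airy_uv w m).1 in let v := (airy_uv w m).2 in
    let W x := x - v x ^+ 2 - u x in (W, fun x => m.+1%:R / W x - v x)
  else (fun=> 0, w).

Variables (a : R) (y : nat -> R -> R).
Hypothesis dy : forall k x, a < x -> is_derive x 1 (y k) (y k.+1 x).
Hypothesis airy : forall x, a < x -> y 2%N x = x * y 0%N x.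
Hypothesis y_neq0 : forall x, a < x -> y 0%N x != 0.
Hypothesis y_bounded : exists M X, forall x, X < x -> `|y 0%N x| <= M.

Let w x := y 1%N x / y 0%N x.
Let u n := (airy_uv w n).1.
Let v n := (airy_uv w n).2.
Let h n x := y 0%N x * \prod_(i < n) u i.+1 x.

(** The logarithmic derivative v_0 of y_0 satisfies v' = x - v^2. It is eventually negative:
    otherwise y_0 y_0' is nonnegative at some positive point, and as it increases strictly there,
    y_0^2 grows at least linearly, against boundedness. *)
Lemma airy_state0 : airy_state a 0 (u 0) (v 0) (h 0).
Proof.
have hE : h 0 = y 0%N by apply/funext => x; rewrite /h big_ord0 mulr1.
rewrite hE; split => [x ax|x ax|x ax|x ax|].
- by rewrite y_neq0.
- by apply: (derE (derC 0 x)); rewrite /u/=; ring.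
- have y0 := y_neq0 ax; apply: (derE (derM (dy 1 ax) (derV y0 (dy 0 ax)))).
  by rewrite airy// /u/v/w/=; field.
- by apply: (derE (dy 0 ax)); rewrite /v/=/w divfK ?y_neq0.
have [M [X0 yM]] := y_bounded.
apply: contrapT => /forall2NP noX.
pose X := Num.max (Num.max a X0) 0.
have aX : a <= X by rewrite /X !le_max lexx.
have [|/existsNP[x0 /not_implyP[]]] := noX (X + 1); first by move=> /negP; lra.
move=> Xx0 /not_andP[/negP|]; last by rewrite oppr0 lexx; case.
rewrite -leNgt => w0.
have Xx x : X < x -> [/\ a < x, X0 < x & 0 < x].
  by rewrite /X !gt_max -andbA => /and3P.
have p0 : 0 <= y 0%N x0 * y 1%N x0.
  have -> : y 0%N x0 * y 1%N x0 = v 0 x0 * y 0%N x0 ^+ 2.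
    by rewrite /v/=/w; field; apply: y_neq0; have [] := Xx x0 _; lra.
  by rewrite mulr_ge0// sqr_ge0.
have pD x : x0 <= x -> is_derive x 1 (fun x => y 0%N x * y 1%N x)
    (x * y 0%N x ^+ 2 + y 1%N x ^+ 2).
  move=> xx; have [|ax _ _] := Xx x; first lra.
  by apply: (derE (derM (dy 0 ax) (dy 1 ax))); rewrite airy//; ring.
have pD0 x : x0 <= x -> 0 < x * y 0%N x ^+ 2 + y 1%N x ^+ 2.
  move=> xx; have [|ax _ x0'] := Xx x; first lra.
  by rewrite ltr_wpDr ?sqr_ge0// mulr_gt0// exprn_even_gt0//= y_neq0.
have p_incr s t : x0 <= s -> s < t ->
    y 0%N s * y 1%N s < y 0%N t * y 1%N t.
  move=> xs st; apply: (slope_gt0 (f := fun x => y 0%N x * y 1%N x) st).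
  - by move=> x /andP[sx _]; apply: pD; lra.
  - by move=> x /andP[sx _]; apply: pD0; lra.
(* At [x0] the product may be 0; one unit further it is strictly positive and serves as a lower
   bound for the slope. *)
pose c := y 0%N (x0 + 1) * y 1%N (x0 + 1).
have c0 : 0 < c.
  by apply: le_lt_trans p0 _; apply: p_incr; lra.
have [||Z xZ HZ] := @slope_unbounded _ (fun x => y 0%N x * y 0%N x)
    (fun x => y 0%N x * y 1%N x + y 0%N x * y 1%N x) (x0 + 1) c c0 _ _ (M * M).
- by move=> x xx; have [|ax _ _] := Xx x; [lra|exact: derM (dy 0 ax) (dy 0 ax)].
- move=> x xx; suff : c < y 0%N x * y 1%N x by lra.
  by apply: p_incr; lra.
have [|aZ XZ _] := Xx (Z + 1); first lra.
have := HZ (Z + 1); have := yM (Z + 1) XZ.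
move=> yZ; rewrite ltrDl ltr01 => /(_ isT); apply/negP; rewrite -leNgt.
by rewrite -expr2 -real_normK ?num_real// expr2 ler_pM.
Qed.

Lemma airy_stateP n : airy_state a n (u n) (v n) (h n).
Proof.
elim: n => [|n IH]; first exact: airy_state0.
have -> : h n.+1 = (fun x => (x - v n x ^+ 2 - u n x) * h n x).
  by apply/funext => x; rewrite /h big_ord_recr/= mulrA mulrC.
exact: airy_state_next IH.
Qed.

Theorem airy_hankel_neq0 n x : a < x ->
  \det (\matrix_(j < n, k < n) y (j + k)%N x) != 0.
Proof.
move=> ax.
have uvE m z : u m.+1 z = z - v m z ^+ 2 - u m z by [].
have u_lt0 m z : a < z -> u m.+1 z < 0 by exact: state_next_neg (airy_stateP m) _.
have vE m z : v m.+1 z = m.+1%:R / u m.+1 z - v m z by [].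
have du m z : a < z -> is_derive z 1 (u m.+1) (u m.+1 z * (v m.+1 z - v m z)).
  move=> az; have u0 : u m.+1 z != 0 by rewrite lt_eqF// u_lt0.
  apply: (derE (state_next_derive (airy_stateP m) az)).
  by rewrite -uvE vE; field.
have dv m z : a < z -> is_derive z 1 (v m) (u m.+1 z - u m z).
  move=> az; have [_ _ Hv _ _] := airy_stateP m.
  by apply: (derE (Hv _ az)); rewrite uvE; ring.
have y1 z : a < z -> y 1%N z = v 0%N z * y 0%N z.
  by move=> az; rewrite /v/=/w divfK// y_neq0.
have -> : \matrix_(j < n, k < n) y (j + k)%N x =
    \matrix_(j < n, k < n) (jacobi_coef (u^~ x) (v^~ x) (j + k) 0 * h 0%N x).
  apply/matrixP => j k; rewrite !mxE /h big_ord0 mulr1.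
  exact: (derivatives_jacobi (a := a)).
rewrite (@hankel_jacobi _ _ _ (h^~ x)); last first.
  by move=> l; rewrite /h big_ord_recr/=; ring.
by apply/prodf_neq0 => l _; have [Hh _ _ _ _] := airy_stateP l; exact: (Hh x ax).1.
Qed.

End AiryHankel.

(** * Improper integrals *)

Section MoreDerivatives.
Context {R : realType}.
Implicit Types f g : R -> R.

Lemma derX f n (x df : R) : is_derive x 1 f df ->
  is_derive x 1 (fun t => f t ^+ n) (n%:R * f x ^+ n.-1 * df).
Proof.
move=> Hf; elim: n => [|n IH]; first by rewrite !mul0r; exact: derC.
have -> : (fun t => f t ^+ n.+1) = (fun t => f t * f t ^+ n).
  by apply/funext => t; rewrite exprS.
apply: (derE (derM Hf IH)); case: n {IH} => [|n]/=; first by ring.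
by rewrite !exprS -[in RHS]natr1; ring.
Qed.

Lemma derexp f (x df : R) : is_derive x 1 f df ->
  is_derive x 1 (fun t => expR (f t)) (expR (f x) * df).
Proof. by move=> Hf; exact: is_derive1_comp (is_derive_expR _) Hf. Qed.

Lemma dercos f (x df : R) : is_derive x 1 f df ->
  is_derive x 1 (fun t => cos (f t)) (- sin (f x) * df).
Proof. by move=> Hf; exact: is_derive1_comp (is_derive_cos _) Hf. Qed.

Lemma dersin f (x df : R) : is_derive x 1 f df ->
  is_derive x 1 (fun t => sin (f t)) (cos (f x) * df).
Proof. by move=> Hf; exact: is_derive1_comp (is_derive_sin _) Hf. Qed.

Lemma der_continuous f (df : R -> R) :
  (forall x : R, is_derive x 1 f (df x)) -> continuous f.
Proof.
by move=> Hf x; apply: differentiable_continuous; apply/derivable1_diffP; case: (Hf x).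
Qed.

End MoreDerivatives.

(** * Domination by a decaying exponential *)

Section ExpDomination.
Context {R : realType}.
Notation mu := (@lebesgue_measure R).

(** By convexity, the cubic lies above its tangent line at [s]. *)
Lemma cube_ge (s t : R) : 0 <= s -> 0 <= t -> s ^+ 2 * t - 2 / 3 * s ^+ 3 <= t ^+ 3 / 3.
Proof.
move=> s0 t0; have : 0 <= (t - s) ^+ 2 * (t + 2 * s).
  by rewrite mulr_ge0 ?sqr_ge0// addr_ge0// mulr_ge0.
have -> : (t - s) ^+ 2 * (t + 2 * s) = t ^+ 3 - 3 * s ^+ 2 * t + 2 * s ^+ 3 by ring.
lra.
Qed.

Lemma exp_cubic_bound (k : nat) (b : R) : exists2 C : R, 0 <= C &
  forall t, 0 <= t -> t ^+ k * expR (- (t ^+ 3 / 3) + b * t) <= C * expR (- t).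
Proof.
(* Chosen so that the tangent slope [s^2] is at least [b + 2]: one unit absorbs [t^k <= k! e^t], the
   other leaves [e^(- t)]. *)
pose s := 1 + `|b + 2|.
exists (k`!%:R * expR (2 / 3 * s ^+ 3)); first by rewrite mulr_ge0// expR_ge0.
move=> t t0.
have tk : t ^+ k <= k`!%:R * expR t.
  case: k => [|k]; first by rewrite expr0 mul1r -expR0 ler_expR.
  rewrite mulrC -ler_pdivrMr ?ltr0n ?fact_gt0//.
  by apply: le_trans (expR_ge1Dxn k t0); rewrite lerDr.
apply: le_trans (ler_wpM2r (expR_ge0 _) tk) _.
rewrite -!mulrA ler_wpM2l// -!expRD ler_expR.
have s0 : 0 <= s by rewrite /s addr_ge0.
have := cube_ge s0 t0.
have : (b + 2) * t <= s ^+ 2 * t.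
  rewrite ler_wpM2r//; have := ler_norm (b + 2); rewrite /s.
  have := normr_ge0 (b + 2); nra.
lra.
Qed.

Lemma continuous_expN (C : R) : continuous (fun t => C * expR (- t)).
Proof.
apply: (@der_continuous _ _ (fun x => C * (expR (- x) * - 1) + expR (- x) * 0)) => x.
exact: derM (derC _ _) (derexp (derN (derI x))).
Qed.

Lemma integral_expN (C T : R) : 0 <= C ->
  (\int[mu]_(t in `[T, +oo[) (C * expR (- t))%:E = (C * expR (- T))%:E)%E.
Proof.
move=> C0.
have D (x : R) : is_derive x 1 (fun t : R => - (C * expR (- t))) (C * expR (- x)).
  by apply: (derE (derN (derM (derC _ _) (derexp (derN (derI x)))))); ring.
rewrite (@ge0_continuous_FTC2y _ _ (fun t => - (C * expR (- t))) _ 0).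
- by rewrite sub0e EFinN oppeK.
- by move=> x _; rewrite mulr_ge0// expR_ge0.
- by apply: continuous_subspaceT; exact: continuous_expN.
- have : - (C * expR (- x)) @[x --> +oo] --> - (C * 0).
    by apply: cvgN; apply: cvgMl_tmp; exact: cvgr_expR.
  by rewrite mulr0 oppr0.
- by move=> x _; have [] := D x.
- by apply: cvg_at_right_filter; exact: (der_continuous D).
- by move=> x _; rewrite derive1E; have [] := D x.
Qed.

Lemma continuous_measurable (f : R -> R) (D : set R) :
  continuous f -> measurable_fun D f.
Proof.
by move=> cf; apply: measurable_funTS; exact: continuous_measurable_fun.
Qed.

Lemma integrable_expN (C T : R) : 0 <= C ->
  mu.-integrable `[T, +oo[ (EFin \o (fun t => C * expR (- t))).
Proof.
move=> C0; apply/integrableP; split.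
  apply/measurable_EFinP; exact: (continuous_measurable (@continuous_expN C)).
under eq_integral do rewrite /= ger0_norm ?mulr_ge0 ?expR_ge0//.
by rewrite integral_expN// ltry.
Qed.

Lemma dominated_integrable (f : R -> R) (C : R) : continuous f ->
  (forall t, 0 <= t -> `|f t| <= C * expR (- t)) ->
  mu.-integrable `[0, +oo[ (EFin \o f).
Proof.
move=> cf fC; have C0 : 0 <= C.
  by have := fC 0 (lexx _); rewrite oppr0 expR0 mulr1; exact: le_trans.
apply: le_integrable (integrable_expN 0 C0) => //.
  apply/measurable_EFinP; exact: (continuous_measurable cf).
move=> t/=; rewrite in_itv/= andbT => t0; rewrite lee_fin.
exact: le_trans (fC t t0) (ler_norm _).
Qed.

Lemma dominated_cvg (f : R -> R) (C : R) : continuous f ->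
  (forall t, 0 <= t -> `|f t| <= C * expR (- t)) ->
  \int[mu]_(t in `[0, T]) f t @[T --> +oo] --> \int[mu]_(t in `[0, +oo[) f t.
Proof.
move=> cf fC; have C0 : 0 <= C.
  by have := fC 0 (lexx _); rewrite oppr0 expR0 mulr1; exact: le_trans.
have If := dominated_integrable cf fC.
have : C * expR (- T) @[T --> +oo] --> (0 : R).
  by rewrite -(mulr0 C); apply: cvgMl_tmp; exact: cvgr_expR.
move=> /cvgrPdist_le E; apply/cvgrPdist_le => e e0; near=> T.
have T0 : 0 <= T by near: T; exact: nbhs_pinfty_ge.
have TE : C * expR (- T) <= e.
  apply: le_trans (ler_norm _) _; rewrite -normrN -sub0r.
  by near: T; exact: E.
have sub : `]T, +oo[ `<=` `[0%R, +oo[.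
  by move=> t/=; rewrite !in_itv/= !andbT => /ltW; exact: le_trans.
have IfT : mu.-integrable `]T, +oo[ (EFin \o f) by apply: integrableS If.
have IeT : mu.-integrable `]T, +oo[ (EFin \o (fun t => C * expR (- t))).
  by apply: integrableS (integrable_expN 0 C0).
rewrite Rintegral_itvB//; apply: le_trans TE.
apply: le_trans (le_normr_Rintegral _ _) _ => //.
apply: (@le_trans _ _ (\int[mu]_(t in `]T, +oo[) (C * expR (- t)))).
  apply: le_Rintegral => //; first exact: integrable_norm.
  by move=> t /sub/=; rewrite in_itv/= andbT; exact: fC.
by rewrite Rintegral_itv_obnd_cbnd// /Rintegral integral_expN.
Unshelve. all: by end_near. Qed.

(** Domination is asked on a unit window around [a] only, since the bounds on the Airy integrands
    grow with the parameter. *)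
Lemma is_derive_under_integral (B : set (measurableTypeR R)) (f df : R -> R -> R) (G : R -> R) (a : R) :
  measurable B ->
  (forall d, mu.-integrable B (EFin \o f d)) ->
  (forall (d t : R), B t -> is_derive d 1 (f^~ t) (df d t)) ->
  (forall t, 0 <= G t) -> mu.-integrable B (EFin \o G) ->
  (forall d t, `|d - a| < 1 -> B t -> `|df d t| <= G t) ->
  is_derive a 1 (fun d => \int[mu]_(t in B) f d t) (\int[mu]_(t in B) df a t).
Proof.
move=> mB If Df G0 IG HG.
have D1 x t : B t -> partial1of2 f x t = df x t.
  by move=> Bt; rewrite partial1of2E; have [] := Df x _ Bt.
have Ia : `]a - 1, a + 1[%classic a by rewrite /= in_itv/=; lra.
have HI x : `]a - 1, a + 1[%classic x -> `|x - a| < 1.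
  by rewrite /= in_itv/= ltr_norml => /andP[? ?]; lra.
have G_ub x t : `]a - 1, a + 1[%classic x -> B t -> `|partial1of2 f x t| <= G t.
  by move=> /HI xa Bt; rewrite D1//; exact: HG.
have Dx x t : `]a - 1, a + 1[%classic x -> B t -> derivable (f^~ t) x 1.
  by move=> _ Bt; have [] := Df x _ Bt.
apply: DeriveDef.
  exact: (derivable_under_integral mB Ia (fun x _ => If x) Dx G0 IG G_ub).
rewrite -derive1E (differentiation_under_integral mB Ia (fun x _ => If x) Dx G0 IG G_ub)//.
by apply: eq_Rintegral => t /set_mem Bt; exact: D1.
Qed.

End ExpDomination.

(** * Trigonometric values at pi/6 and pi/3 *)

Section Trigo.
Context {R : realType}.

Lemma sin_mulr3n (x : R) : sin (3 * x) = sin x * (3 - 4 * sin x ^+ 2).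
Proof.
have -> : 3 * x = x *+ 2 + x by rewrite mulr2n; ring.
rewrite sinD sin_mulr2n cos_mulr2n !mulr2n cos2sin2.
have -> : (cos x * sin x + cos x * sin x) * cos x = 2 * sin x * cos x ^+ 2 by ring.
rewrite cos2sin2; ring.
Qed.

Lemma sin_pi6 : sin (pi / 6) = 2^-1 :> R.
Proof.
have p0 := pi_gt0 R.
have s0 : 0 < sin (pi / 6 : R) by apply: sin_gt0_pi; apply/andP; split; lra.
have : sin (3 * (pi / 6)) = 1 :> R.
  have -> : 3 * (pi / 6) = pi / 2 :> R by field.
  exact: sin_pihalf.
rewrite sin_mulr3n => E.
(* The triple-angle equation 3 s - 4 s^3 = 1 factors, and s > 0 excludes the root -1. *)
have : (sin (pi / 6 : R) + 1) * (2 * sin (pi / 6 : R) - 1) ^+ 2 = 0.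
  rewrite [LHS](_ : _ = 1 - sin (pi / 6) * (3 - 4 * sin (pi / 6) ^+ 2)); last by ring.
  by rewrite E subrr.
move=> /eqP; rewrite mulf_eq0 sqrf_eq0 gt_eqF/=; last lra.
by move=> /eqP; lra.
Qed.

Lemma cos_pi3 : cos (pi / 3) = 2^-1 :> R.
Proof.
have -> : pi / 3 = - (pi / 6 - pi / 2) :> R by field.
by rewrite cosN cosBpihalf sin_pi6.
Qed.

Lemma sin_pi3 : sin (pi / 3) = cos (pi / 6) :> R.
Proof.
have -> : pi / 3 = - (pi / 6) + pi / 2 :> R by field.
by rewrite sinDpihalf cosN.
Qed.

End Trigo.

(** * The real Airy moments *)

Section AiryMoments.
Context {R : realType}.
Notation mu := (@lebesgue_measure R).

(** Argument of the moment integrand on the ray z = t e^(i pi/6), dz included, after division by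
    i^k: (k + 1) pi/6 - k pi/2 = pi/6 - k pi/3. *)
Definition airy_phase (k : nat) (d t : R) : R :=
  pi / 6 - k%:R * (pi / 3) - cos (pi / 6) * d * t.

Definition airy_integrand (k : nat) (d t : R) : R :=
  t ^+ k * expR (- (t ^+ 3 / 3) + d / 2 * t) * cos (airy_phase k d t).

(** The factor 2 arises because, up to i^k, the two rays contribute complex conjugates. *)
Definition airy_moment (k : nat) (d : R) : R :=
  2 * \int[mu]_(t in `[0, +oo[) airy_integrand k d t.

Lemma airy_phaseS k (d t : R) : airy_phase k.+1 d t = airy_phase k d t - pi / 3.
Proof. by rewrite /airy_phase -natr1; ring. Qed.

(** Differentiating in [d] multiplies by t e^(- i pi/3) before taking real parts, which lowers the
    phase by pi/3. *)
Lemma derive_airy_integrand k (d t : R) :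
  is_derive d 1 (airy_integrand k ^~ t) (airy_integrand k.+1 d t).
Proof.
have De : is_derive d 1 (fun d => - (t ^+ 3 / 3) + d / 2 * t) (t / 2).
  apply: (derE (derD (derC (- (t ^+ 3 / 3)) d) (derM (derM (derI d) (derC 2^-1 d)) (derC t d)))).
  by cbv beta; ring.
have Dp : is_derive d 1 (fun d => airy_phase k d t) (- (cos (pi / 6) * t)).
  apply: (derE (derD (derC (pi / 6 - k%:R * (pi / 3)) d)
    (derN (derM (derM (derC (cos (pi / 6)) d) (derI d)) (derC t d))))).
  by cbv beta; ring.
apply: (derE (derM (derM (derC (t ^+ k) d) (derexp De)) (dercos Dp))).
rewrite /airy_integrand airy_phaseS (cosB (airy_phase k d t)) cos_pi3 sin_pi3 (exprSr t k).
by cbv beta; field.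
Qed.

Lemma derive_cubic_exponent (d t : R) :
  is_derive t 1 (fun t => - (t ^+ 3 / 3) + d / 2 * t) (d / 2 - t ^+ 2).
Proof.
apply: (derE (derD (derN (derM (derX 3 (derI t)) (derC 3^-1 t)))
  (derM (derC (d / 2) t) (derI t)))).
by cbv beta => /=; field.
Qed.

Lemma derive_airy_phase k (d t : R) :
  is_derive t 1 (airy_phase k d) (- (cos (pi / 6) * d)).
Proof.
apply: (derE (derD (derC (pi / 6 - k%:R * (pi / 3)) t)
  (derN (derM (derC (cos (pi / 6) * d) t) (derI t))))).
by cbv beta; ring.
Qed.

Lemma continuous_airy_integrand k (d : R) : continuous (airy_integrand k d).
Proof.
apply: der_continuous => t.
exact: derM (derM (derX k (derI t)) (derexp (derive_cubic_exponent d t)))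
  (dercos (derive_airy_phase k d t)).
Qed.

Lemma airy_integrand_bound k (d D t : R) : 0 <= t -> d <= D ->
  `|airy_integrand k d t| <= t ^+ k * expR (- (t ^+ 3 / 3) + D / 2 * t).
Proof.
move=> t0 dD; rewrite /airy_integrand normrM.
rewrite ger0_norm ?mulr_ge0 ?exprn_ge0 ?expR_ge0//.
apply: le_trans (ler_wpM2l _ (cos_max _)) _; first by rewrite mulr_ge0 ?exprn_ge0 ?expR_ge0.
rewrite mulr1 ler_wpM2l ?exprn_ge0// ler_expR lerD2l ler_wpM2r//; lra.
Qed.

Lemma airy_integrand_dominated k (D : R) : exists2 C : R, 0 <= C &
  forall d t, 0 <= t -> d <= D -> `|airy_integrand k d t| <= C * expR (- t).
Proof.
have [C C0 HC] := exp_cubic_bound k (D / 2).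
exists C => // d t t0 dD.
exact: le_trans (airy_integrand_bound k t0 dD) (HC t t0).
Qed.

Lemma integrable_airy_integrand k (d : R) :
  mu.-integrable `[0, +oo[ (EFin \o airy_integrand k d).
Proof.
have [C C0 HC] := airy_integrand_dominated k d.
apply: dominated_integrable (@continuous_airy_integrand k d) _ => t t0.
exact: HC.
Qed.

Lemma derive_airy_moment k (d : R) :
  is_derive d 1 (airy_moment k) (airy_moment k.+1 d).
Proof.
have [C C0 HC] := airy_integrand_dominated k.+1 (d + 1).
apply: (derE (derM (derC 2 d) (is_derive_under_integral
  (G := fun t => C * expR (- t)) (df := airy_integrand k.+1) _ _ _ _ _ _))).
- exact: measurable_itv.
- exact: integrable_airy_integrand.
- by move=> x t _; exact: derive_airy_integrand.
- by move=> t; rewrite mulr_ge0// expR_ge0.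
- exact: integrable_expN.
- move=> x t xd; rewrite /= in_itv/= andbT => t0; apply: HC => //.
  by move: xd; rewrite ltr_norml => /andP[_]; lra.
- by cbv beta; rewrite mulr0 addr0.
Qed.

Lemma derive_FTC (f F : R -> R) (T : R) : continuous f ->
  (forall t : R, is_derive t 1 F (f t)) -> 0 <= T ->
  \int[mu]_(t in `[0, T]) f t = F T - F 0.
Proof.
move=> cf DF; rewrite le_eqVlt => /predU1P[<-|T0].
  by rewrite set_itv1 Rintegral_set1 subrr.
have cF := der_continuous DF.
rewrite /Rintegral (continuous_FTC2 T0 (F := F))//.
- exact: continuous_subspaceT.
- split.
  + by move=> t _; have [] := DF t.
  + by apply: cvg_at_right_filter; exact: cF.
  + by apply: cvg_at_left_filter; exact: cF.
- by move=> t _; rewrite derive1E; have [] := DF t.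
Qed.

Lemma airy_moment2 (d : R) : airy_moment 2 d = - d * airy_moment 0 d.
Proof.
(* Minus the imaginary part of e^(i (z^3/3 - d z)) on the ray: the relation is the integral of an
   exact derivative, vanishing at 0 and at infinity. *)
pose F t := expR (- (t ^+ 3 / 3) + d / 2 * t) * sin (cos (pi / 6) * d * t).
have DF (t : R) : is_derive t 1 F (airy_integrand 2 d t + d * airy_integrand 0 d t).
  have Ds : is_derive t 1 (fun t => cos (pi / 6) * d * t) (cos (pi / 6) * d).
    apply: (derE (derM (derC (cos (pi / 6) * d) t) (derI t))).
    by cbv beta; ring.
  apply: (derE (derM (derexp (derive_cubic_exponent d t)) (dersin Ds))).
  rewrite /airy_integrand /airy_phase.
  set b := cos (pi / 6) * d * t.
  have -> : pi / 6 - 2 * (pi / 3) - b = - (b + pi / 2) by field.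
  have -> : pi / 6 - 0%:R * (pi / 3) - b = pi / 6 - b by ring.
  by rewrite cosN cosDpihalf cosB sin_pi6; cbv beta; field.
have [C2 C20 H2] := airy_integrand_dominated 2 d.
have [C0 C00 H0] := airy_integrand_dominated 0 d.
pose f t := airy_integrand 2 d t + d * airy_integrand 0 d t.
have cf : continuous f.
  move=> t; apply: cvgD; first exact: continuous_airy_integrand.
  by apply: cvgMl_tmp; exact: continuous_airy_integrand.
have fC t : 0 <= t -> `|f t| <= (C2 + `|d| * C0) * expR (- t).
  move=> t0; apply: le_trans (ler_normD _ _) _.
  rewrite mulrDl lerD ?H2// normrM -mulrA ler_wpM2l//; exact: H0.
have lim1 := dominated_cvg cf fC.
have F0 : F 0 = 0 by rewrite /F (mulr0 (cos (pi / 6) * d)) sin0 mulr0.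
have lim2 : \int[mu]_(t in `[0, T]) f t @[T --> +oo] --> (0 : R).
  have [C C_ge0 HC] := exp_cubic_bound 0 (d / 2).
  have E0 : C * expR (- T) @[T --> +oo] --> (0 : R).
    by rewrite -(mulr0 C); apply: cvgMl_tmp; exact: cvgr_expR.
  apply: norm_cvg0; apply: squeeze_cvgr E0; last exact: cvg_cst.
  near=> T; have T0 : 0 <= T by near: T; exact: nbhs_pinfty_ge.
  rewrite normr_ge0/= (derive_FTC cf DF T0) F0 subr0.
  apply: le_trans (HC T T0); rewrite expr0 mul1r normrM ger0_norm ?expR_ge0//.
  by rewrite ler_piMr ?expR_ge0// sin_max.
have : \int[mu]_(t in `[0, +oo[) f t = 0 by exact: cvg_unique lim1 lim2.
have I2 := integrable_airy_integrand 2 d.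
have I0 := integrable_airy_integrand 0 d.
rewrite /f RintegralD//; last first.
  by apply: integrableZl I0.
rewrite RintegralZl// /airy_moment; lra.
Unshelve. all: by end_near. Qed.

Lemma airy_moment_bounded : exists M : R, forall d, d <= 0 -> `|airy_moment 0 d| <= M.
Proof.
have [C C0 HC] := airy_integrand_dominated 0 0.
exists (2 * C) => d d0; rewrite /airy_moment normrM ger0_norm// ler_wpM2l//.
apply: le_trans (le_normr_Rintegral _ (integrable_airy_integrand 0 d)) _ => //.
have -> : C = \int[mu]_(t in `[0, +oo[) (C * expR (- t)).
  by rewrite /Rintegral integral_expN//= oppr0 expR0 mulr1.
apply: le_Rintegral => //.
- exact: integrable_norm (integrable_airy_integrand 0 d).
- exact: integrable_expN.
- by move=> t; rewrite /= in_itv/= andbT => t0; exact: HC.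
Qed.

End AiryMoments.

(** * Rotation of the Airy integral *)

Section Rotation.
Context {R : realType}.
Notation mu := (@lebesgue_measure R).
Variable d : R.

(* With [z = t e^(i th)], [exp (i (z^3 / 3 - d z)) e^(i th)] is
   [exp (- rotA) e^(i rotB)]. *)
Let rotA (th t : R) := t ^+ 3 * (sin (3 * th) / 3) - d * t * sin th.
Let rotB (th t : R) := t ^+ 3 * (cos (3 * th) / 3) - d * t * cos th + th.
Let g th t := expR (- rotA th t) * cos (rotB th t).
Let dg th t := expR (- rotA th t) *
  (- (t ^+ 3 * cos (3 * th) - d * t * cos th) * cos (rotB th t)
   - (1 - t ^+ 3 * sin (3 * th) + d * t * sin th) * sin (rotB th t)).
Let k th t := - (t * (expR (- rotA th t) * sin (rotB th t))).

Let derive_rotA_angle (th t : R) : is_derive th 1 (fun th => - rotA th t)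
  (- (t ^+ 3 * cos (3 * th) - d * t * cos th)).
Proof.
apply: (derE (derN (derD
  (derM (derC (t ^+ 3) th) (derM (dersin (derM (derC 3 th) (derI th))) (derC 3^-1 th)))
  (derN (derM (derC (d * t) th) (dersin (derI th))))))).
by cbv beta; field.
Qed.

Let derive_rotB_angle (th t : R) : is_derive th 1 (fun th => rotB th t)
  (1 - t ^+ 3 * sin (3 * th) + d * t * sin th).
Proof.
apply: (derE (derD (derD
  (derM (derC (t ^+ 3) th) (derM (dercos (derM (derC 3 th) (derI th))) (derC 3^-1 th)))
  (derN (derM (derC (d * t) th) (dercos (derI th))))) (derI th))).
by cbv beta; field.
Qed.

Let derive_rotA_radius (th t : R) : is_derive t 1 (fun t => - rotA th t)
  (- (t ^+ 2 * sin (3 * th) - d * sin th)).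
Proof.
apply: (derE (derN (derD (derM (derX 3 (derI t)) (derC (sin (3 * th) / 3) t))
  (derN (derM (derM (derC d t) (derI t)) (derC (sin th) t)))))).
by cbv beta => /=; field.
Qed.

Let derive_rotB_radius (th t : R) : is_derive t 1 (rotB th)
  (t ^+ 2 * cos (3 * th) - d * cos th).
Proof.
apply: (derE (derD (derD (derM (derX 3 (derI t)) (derC (cos (3 * th) / 3) t))
  (derN (derM (derM (derC d t) (derI t)) (derC (cos th) t)))) (derC th t))).
by cbv beta => /=; field.
Qed.

Let derive_g (th t : R) : is_derive th 1 (g^~ t) (dg th t).
Proof.
apply: (derE (derM (derexp (derive_rotA_angle th t)) (dercos (derive_rotB_angle th t)))).
by rewrite /dg; cbv beta; ring.
Qed.

(** This is the Cauchy-Riemann equation in polar form: for holomorphic f, the angular derivative of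
    f(z) e^(i th) is the radial derivative of i t f(z) e^(i th), whose real part is [k]. *)
Let derive_k (th t : R) : is_derive t 1 (k th) (dg th t).
Proof.
apply: (derE (derN (derM (derI t) (derM (derexp (derive_rotA_radius th t))
  (dersin (derive_rotB_radius th t)))))).
by rewrite /dg; cbv beta; ring.
Qed.

Let continuous_g th : continuous (g th).
Proof.
exact: der_continuous.
Qed.

Let continuous_dg th : continuous (dg th).
Proof.
exact: der_continuous.
Qed.

Let dg_bound (T : R) : 0 <= T -> exists2 M, 0 <= M &
  forall th t, 0 <= t <= T -> `|dg th t| <= M.
Proof.
move=> T0; pose N := T ^+ 3 + `|d| * T.
have N0 : 0 <= N by rewrite addr_ge0 ?exprn_ge0// mulr_ge0.
exists (expR N * (N + (1 + N))); first by rewrite mulr_ge0 ?expR_ge0//; lra.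
move=> th t /andP[t0 tT].
have lin (a b : R) : `|a| <= 1 -> `|b| <= 1 -> `|t ^+ 3 * a - d * t * b| <= N.
  move=> a1 b1; apply: le_trans (ler_normB _ _) _; rewrite /N lerD//.
    rewrite normrM ger0_norm ?exprn_ge0//.
    apply: le_trans (ler_wpM2l _ a1) _; first exact: exprn_ge0.
    by rewrite mulr1 lerXn2r.
  rewrite normrM normrM (ger0_norm t0) -mulrA ler_wpM2l//.
  by apply: le_trans (ler_wpM2l t0 b1) _; rewrite mulr1.
have third (a : R) : `|a| <= 1 -> `|a / 3| <= 1.
  by move=> a1; rewrite normrM (@ger0_norm _ 3^-1)//; lra.
rewrite /dg normrM ger0_norm ?expR_ge0// ler_pM ?expR_ge0//.
  rewrite ler_expR; apply: le_trans (ler_norm _) _; rewrite normrN.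
  exact: lin (third _ (sin_max _)) (sin_max _).
apply: le_trans (ler_normB _ _) _; rewrite !normrM normrN lerD//.
  rewrite -[leRHS]mulr1 ler_pM// ?cos_max//.
  exact: lin (cos_max _) (cos_max _).
rewrite -[leRHS]mulr1 ler_pM// ?sin_max//.
have -> : 1 - t ^+ 3 * sin (3 * th) + d * t * sin th =
  1 - (t ^+ 3 * sin (3 * th) - d * t * sin th) by ring.
apply: le_trans (ler_normB _ _) _; rewrite normr1 lerD2l.
exact: lin (sin_max _) (sin_max _).
Qed.

(** Cauchy's theorem on a sector in differential form: turning the segment changes the integral by
    the contribution [k th T] of the arc. *)
Let derive_rotated (T th : R) : 0 <= T ->
  is_derive th 1 (fun th => \int[mu]_(t in `[0, T]) g th t) (k th T).
Proof.
move=> T0; have [M M0 HM] := dg_bound T0.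
apply: (derE (is_derive_under_integral (G := fun=> M) (df := dg) _ _ _ _ _ _)).
- exact: measurable_itv.
- move=> x; apply: continuous_compact_integrable; first exact: segment_compact.
  by apply: continuous_subspaceT; exact: continuous_g.
- by move=> x t _; exact: derive_g.
- by [].
- apply: continuous_compact_integrable; first exact: segment_compact.
  by apply: continuous_subspaceT; exact: cst_continuous.
- by move=> x t _; rewrite /= in_itv/=; exact: HM.
- rewrite (derive_FTC (@continuous_dg th) (derive_k th) T0) /k mul0r oppr0 subr0.
  by [].
Qed.

Let sin_cos_small (th : R) : 0 <= th <= pi / 6 ->
  0 <= sin th <= 2^-1 /\ 2^-1 <= cos th.
Proof.
move=> /andP[th0 th6]; have p0 := pi_gt0 R.
have s0 : 0 <= sin th by apply: sin_ge0_pi; apply/andP; split; lra.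
have c0 x : 0 <= x <= pi / 6 -> 0 <= cos (x : R).
  by move=> /andP[? ?]; apply: cos_ge0_pihalf; apply/andP; split; lra.
have s2 : sin th <= 2^-1.
  rewrite -sin_pi6 -subr_ge0 -(mul0r (pi / 6 - th)).
  apply: (@slope_ge _ sin cos) => // x /andP[tx x6].
  by apply: c0; rewrite x6 andbT; lra.
split; first by rewrite s0.
have := cos2Dsin2 th; have := c0 th; rewrite th0 th6 => /(_ isT).
by move=> c_ge0 E; rewrite leNgt; apply/negP => c2; nra.
Qed.

(** On the sector [sin (3 th) >= 2 sin th], and [d <= T^2 / 6], so [rotA] is at least
    [T^3 / 2 * sin th]. The factor [2 cos th >= 1] is inserted to make the bound an exact derivative
    in [th]. *)
Let k_bound (T th : R) : 1 <= T -> 6 * `|d| <= T -> 0 <= th <= pi / 6 ->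
  `|k th T| <= 2 * T * cos th * expR (- (T ^+ 3 / 2 * sin th)).
Proof.
move=> T1 dT /sin_cos_small[/andP[s0 s2] c2].
have T0 : 0 <= T by lra.
have e0 := expR_ge0 (- rotA th T).
have AE : T ^+ 3 / 2 * sin th <= rotA th T.
  rewrite /rotA sin_mulr3n.
  have -> : T ^+ 3 * (sin th * (3 - 4 * sin th ^+ 2) / 3) - d * T * sin th =
    (T * (T ^+ 2 * (3 - 4 * sin th ^+ 2) / 3 - d)) * sin th by field.
  rewrite ler_wpM2r//.
  have -> : T ^+ 3 / 2 = T * (T ^+ 2 / 2) by field.
  rewrite ler_wpM2l//.
  have s4 : sin th ^+ 2 <= 4^-1 by nra.
  have T2 : T <= T ^+ 2 by nra.
  have := ler_norm d.
  have : T ^+ 2 * 2 <= T ^+ 2 * (3 - 4 * sin th ^+ 2).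
    by rewrite ler_wpM2l ?sqr_ge0//; lra.
  lra.
rewrite /k normrN normrM ger0_norm// normrM (ger0_norm e0).
apply: (@le_trans _ _ (T * expR (- rotA th T))).
  by rewrite ler_wpM2l// ler_piMr// sin_max.
apply: (@le_trans _ _ (T * expR (- (T ^+ 3 / 2 * sin th)))).
  by rewrite ler_wpM2l// ler_expR lerN2.
rewrite ler_wpM2r ?expR_ge0//; nra.
Qed.

Let rotation_bound (T : R) : 1 <= T -> 6 * `|d| <= T ->
  `|\int[mu]_(t in `[0, T]) g (pi / 6) t - \int[mu]_(t in `[0, T]) g 0 t| <= 4 / T.
Proof.
move=> T1 dT; have T0 : 0 < T by lra.
have p0 := pi_gt0 R.
pose D th := \int[mu]_(t in `[0, T]) g th t.
(* An antiderivative of the bound on [|k th T|]; hence [M + D] and [M - D] are nondecreasing and the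
   variation of [D] is at most that of [M]. *)
pose M th := - (4 / T ^+ 2 * expR (- (T ^+ 3 / 2 * sin th))).
have DM (th : R) : is_derive th 1 M (2 * T * cos th * expR (- (T ^+ 3 / 2 * sin th))).
  apply: (derE (derN (derM (derC (4 / T ^+ 2) th)
    (derexp (derN (derM (derC (T ^+ 3 / 2) th) (dersin (derI th)))))))).
  by cbv beta; field; rewrite gt_eqF.
have DD (th : R) : is_derive th 1 D (k th T) by apply: derive_rotated; lra.
have M4 : M (pi / 6) - M 0 <= 4 / T.
  rewrite /M sin0 mulr0 oppr0 expR0 mulr1 opprK addrC.
  apply: (@le_trans _ _ (4 / T ^+ 2)).
    by rewrite gerBl mulr_ge0 ?expR_ge0// divr_ge0// sqr_ge0.
  by rewrite ler_wpM2l// lef_pV2 ?posrE ?exprn_gt0//; nra.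
have k0 th : 0 <= th <= pi / 6 -> `|k th T| <= 2 * T * cos th * expR (- (T ^+ 3 / 2 * sin th)).
  exact: k_bound.
have pi6 : 0 <= pi / 6 :> R by lra.
have up := @slope_ge _ (fun th => M th - D th)
  (fun th => 2 * T * cos th * expR (- (T ^+ 3 / 2 * sin th)) - k th T) 0 (pi / 6) 0 pi6
  (fun x _ => derD (DM x) (derN (DD x))).
have down := @slope_ge _ (fun th => M th + D th)
  (fun th => 2 * T * cos th * expR (- (T ^+ 3 / 2 * sin th)) + k th T) 0 (pi / 6) 0 pi6
  (fun x _ => derD (DM x) (DD x)).
rewrite ler_norml; apply/andP; split.
- suff : 0 * (pi / 6 - 0) <= M (pi / 6) + D (pi / 6) - (M 0 + D 0).
    by rewrite mul0r -/(D _) -/(D _); lra.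
  by apply: down => x /k0; rewrite ler_norml => /andP[]; lra.
- suff : 0 * (pi / 6 - 0) <= M (pi / 6) - D (pi / 6) - (M 0 - D 0).
    by rewrite mul0r -/(D _) -/(D _); lra.
  by apply: up => x /k0; rewrite ler_norml => /andP[]; lra.
Qed.

(** Angle 0 gives Airy's oscillating integrand and angle pi/6 the absolutely integrable one; the
    truncated integrals differ by at most 4 / T. *)
Lemma Ai_airy_moment : Ai (- d) = airy_moment 0 d / (2 * pi).
Proof.
have [C C0 HC] := airy_integrand_dominated 0 d.
have lim1 := dominated_cvg (@continuous_airy_integrand _ 0 d)
  (fun t t0 => HC d t t0 (lexx d)).
have gE : g (pi / 6) = airy_integrand 0 d.
  apply/funext => t; rewrite /g /rotA /rotB /airy_integrand /airy_phase.
  have -> : 3 * (pi / 6) = pi / 2 :> R by field.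
  rewrite sin_pihalf cos_pihalf sin_pi6 (expr0 t) (mul1r (expR _)).
  by congr (expR _ * cos _); field.
have g0E t : g 0 t = cos (t ^+ 3 / 3 + - d * t).
  rewrite /g /rotA /rotB mulr0 sin0 cos0 mul0r !mulr0 subr0 oppr0 expR0 mul1r.
  by congr cos; field.
have lim2 : \int[mu]_(t in `[0, T]) cos (t ^+ 3 / 3 + - d * t) @[T --> +oo] -->
    \int[mu]_(t in `[0, +oo[) airy_integrand 0 d t.
  have -> : (fun T => \int[mu]_(t in `[0, T]) cos (t ^+ 3 / 3 + - d * t)) =
      (fun T => \int[mu]_(t in `[0, T]) airy_integrand 0 d t -
        (\int[mu]_(t in `[0, T]) g (pi / 6) t - \int[mu]_(t in `[0, T]) g 0 t)).
    apply/funext => T; rewrite gE opprB addrC subrK.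
    by apply: eq_Rintegral => t _; rewrite g0E.
  rewrite -[X in _ --> X]subr0; apply: cvgB => //.
  apply/cvgr0Pnorm_le => e e0; near=> T.
  have T1 : 1 <= T by near: T; exact: nbhs_pinfty_ge (num_real _).
  have Te : 4 / e <= T by near: T; exact: nbhs_pinfty_ge (num_real _).
  apply: le_trans (rotation_bound T1 _) _.
    by near: T; exact: nbhs_pinfty_ge (num_real _).
  by rewrite ler_pdivrMr; [rewrite mulrC -ler_pdivrMr|lra].
have : (pi : R) != 0 by rewrite gt_eqF// pi_gt0.
rewrite /Ai (cvg_lim _ lim2)// /airy_moment.
by move: (pi : R) => p p0; field.
Unshelve. all: by end_near. Qed.

End Rotation.

(** * The complex moments *)

Local Open Scope complex_scope.

Section ComplexMoments.
Context {R : realType}.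
Notation mu := (@lebesgue_measure R).
Implicit Types (z w : R[i]) (x : R).

Definition cis (x : R) : R[i] := cos x +i* sin x.

Lemma cexpE (a b : R) : cexp (a +i* b) = (expR a)%:C * cis b.
Proof. by apply/eqP; rewrite eq_complex/= !mul0r subr0 addr0 !eqxx. Qed.

Lemma cisD (a b : R) : cis (a + b) = cis a * cis b.
Proof.
by apply/eqP; rewrite eq_complex/= cosD sinD; apply/andP; split; apply/eqP; ring.
Qed.

Lemma cis_mulrn (a : R) n : cis (n%:R * a) = cis a ^+ n.
Proof.
elim: n => [|n IH]; last by rewrite -natr1 mulrDl mul1r cisD IH exprSr.
by rewrite mul0r expr0 /cis cos0 sin0.
Qed.

Lemma cis_pihalf : cis (pi / 2) = 'i%C.
Proof. by rewrite /cis cos_pihalf sin_pihalf. Qed.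

Lemma cis_pi : cis pi = -1.
Proof. by apply/eqP; rewrite eq_complex/= cospi sinpi oppr0 !eqxx. Qed.

Lemma cintegralZ (D : set (measurableTypeR R)) w (g h : R -> R) : measurable D ->
  mu.-integrable D (EFin \o g) -> mu.-integrable D (EFin \o h) ->
  cintegral D (fun t => w * (g t +i* h t)) =
  w * ((\int[mu]_(t in D) g t) +i* (\int[mu]_(t in D) h t)).
Proof.
case: w => a b mD Ig Ih; apply/eqP; rewrite eq_complex/=.
have I f c : mu.-integrable D (EFin \o f) -> mu.-integrable D (EFin \o (fun t => c * f t)).
  by move=> If; apply: integrableZl If.
rewrite RintegralB ?RintegralD ?RintegralZl ?eqxx//; exact: I.
Qed.

(** The condition, met by pi/6 and 5 pi/6, turns i z^3/3 into - t^3/3. The last factor [cis th] is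
    dz/dt and accounts for [k.+1] in the phase. *)
Lemma moment_integrand (th d t : R) k : cis (3 * th) = 'i%C ->
  let z := t%:C * cis th in
  z ^+ k * cexp ('i%C * (z ^+ 3 / 3 - d%:C * z)) * cis th =
  (t ^+ k * expR (- (t ^+ 3 / 3) + d * t * sin th))%:C *
    cis (k.+1%:R * th - d * t * cos th).
Proof.
move=> c3 z.
have -> : 'i%C * (z ^+ 3 / 3 - d%:C * z) =
    (- (t ^+ 3 / 3) + d * t * sin th) +i* (- (d * t * cos th)).
  rewrite /z exprMn -cis_mulrn c3 -rmorphXn.
  have -> : (3 : R[i])^-1 = (3^-1 : R)%:C by rewrite fmorphV rmorph_nat.
  by apply/eqP; rewrite eq_complex/=; apply/andP; split; apply/eqP; ring.
rewrite cexpE cisD cis_mulrn (exprS (cis th)) /z exprMn -rmorphXn rmorphM.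
ring.
Qed.

Lemma airy_sine_integrable k d : mu.-integrable `[0, +oo[
  (EFin \o (fun t : R => t ^+ k * expR (- (t ^+ 3 / 3) + d / 2 * t) * sin (airy_phase k d t))).
Proof.
have [C C0 HC] := exp_cubic_bound k (d / 2).
apply: (dominated_integrable (C := C)).
  apply: der_continuous => t.
  exact: derM (derM (derX k (derI t)) (derexp (derive_cubic_exponent d t)))
    (dersin (derive_airy_phase k d t)).
move=> t t0; apply: le_trans (HC t t0).
have p0 : 0 <= t ^+ k * expR (- (t ^+ 3 / 3) + d / 2 * t).
  by rewrite mulr_ge0 ?exprn_ge0 ?expR_ge0.
by rewrite normrM (ger0_norm p0) ler_piMr// sin_max.
Qed.

Lemma moment_airy k (d : R) : moment k d = 'i%C ^+ k * (airy_moment k d)%:C.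
Proof.
pose E t := t ^+ k * expR (- (t ^+ 3 / 3) + d / 2 * t).
pose b := airy_phase k d.
have cexp_ray (th : R) : cexp ('i%C * th%:C) = cis th.
  have -> : 'i%C * th%:C = 0 +i* th.
    by apply/eqP; rewrite eq_complex/=; apply/andP; split; apply/eqP; ring.
  by rewrite cexpE expR0 mul1r.
have ik (x : R) : cis (x + k%:R * (pi / 2)) = 'i%C ^+ k * cis x.
  by rewrite cisD cis_mulrn cis_pihalf mulrC.
have out : (fun t : R => (t%:C * cis (pi / 6)) ^+ k *
    cexp ('i%C * ((t%:C * cis (pi / 6)) ^+ 3 / 3 - d%:C * (t%:C * cis (pi / 6)))) *
    cis (pi / 6)) =
    (fun t => 'i%C ^+ k * ((E t * cos (b t)) +i* (E t * sin (b t)))).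
  apply/funext => t; rewrite moment_integrand; last first.
    by rewrite -cis_pihalf; congr cis; field.
  have -> : k.+1%:R * (pi / 6) - d * t * cos (pi / 6) = b t + k%:R * (pi / 2).
    by rewrite /b /airy_phase -natr1; field.
  rewrite ik sin_pi6 /E (_ : d * t * 2^-1 = d / 2 * t); last by ring.
  rewrite mulrCA; congr (_ * _); apply/eqP.
  by rewrite eq_complex/= !mul0r subr0 addr0 !eqxx.
have cis56 : cis (5 * pi / 6) = - cis (- (pi / 6)).
  by rewrite -mulN1r -cis_pi -cisD; congr cis; field.
(* The second ray mirrors the first in the imaginary axis: up to i^k, its integrand is minus the
   conjugate, so subtracting it cancels the imaginary parts and doubles the real ones. *)
have inn : (fun t : R => (t%:C * cis (5 * pi / 6)) ^+ k *
    cexp ('i%C * ((t%:C * cis (5 * pi / 6)) ^+ 3 / 3 - d%:C * (t%:C * cis (5 * pi / 6)))) *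
    cis (5 * pi / 6)) =
    (fun t => - 'i%C ^+ k * ((E t * cos (b t)) +i* - (E t * sin (b t)))).
  apply/funext => t; rewrite moment_integrand; last first.
    have -> : 3 * (5 * pi / 6) = pi / 2 + pi + pi :> R by field.
    by rewrite (cisD (pi / 2 + pi)) (cisD (pi / 2)) cis_pi cis_pihalf; ring.
  have [-> ->] : cos (5 * pi / 6) = - cos (pi / 6) :> R /\ sin (5 * pi / 6) = 2^-1 :> R.
    have -> : 5 * pi / 6 = - (pi / 6) + pi :> R by field.
    by rewrite cosDpi sinDpi cosN sinN opprK sin_pi6.
  have -> : k.+1%:R * (5 * pi / 6) - d * t * - cos (pi / 6) =
      - b t + k%:R * (pi / 2) + pi.
    by rewrite /b /airy_phase -natr1; field.
  rewrite cisD cis_pi ik /E (_ : d * t * 2^-1 = d / 2 * t); last by ring.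
  have -> : cis (- b t) = cos (b t) +i* - sin (b t) by rewrite /cis cosN sinN.
  rewrite mulrN1 mulrN mulrCA -mulNr; congr (_ * _); apply/eqP.
  by rewrite eq_complex/= !mul0r subr0 addr0 mulrN !eqxx.
have Ig : mu.-integrable `[0, +oo[ (EFin \o (fun t => E t * cos (b t))).
  exact: integrable_airy_integrand.
have Ih : mu.-integrable `[0, +oo[ (EFin \o (fun t => E t * sin (b t))).
  exact: airy_sine_integrable.
have IhN : mu.-integrable `[0, +oo[ (EFin \o (fun t => - (E t * sin (b t)))).
  by have := integrableN Ih; congr integrable.
rewrite /moment /Gamma_integral /ray_integral !cexp_ray out inn !cintegralZ//.
have -> : \int[mu]_(t in `[0, +oo[) - (E t * sin (b t)) =
    - \int[mu]_(t in `[0, +oo[) (E t * sin (b t)).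
  rewrite -mulN1r -RintegralZl//.
  by apply: eq_Rintegral => t _; rewrite mulN1r.
rewrite mulNr opprK -mulrDr; congr (_ * _); apply/eqP.
by rewrite eq_complex/= subrr eqxx andbT /airy_moment mulrDl !mul1r.
Qed.

End ComplexMoments.

(** * Reduction of the complex determinant to the real one *)

(** The factor c^(j+k) splits as c^j c^k, that is, a diagonal matrix on each side. It serves for c =
    i and c = -1. *)
Lemma det_hankel_scale (K : comNzRingType) n (c : K) (f : nat -> K) :
  \det (\matrix_(j < n, k < n) (c ^+ (j + k) * f (j + k)%N)) =
  (\prod_(i < n) c ^+ i) ^+ 2 * \det (\matrix_(j < n, k < n) f (j + k)%N).
Proof.
pose D := diag_mx (\row_(i < n) c ^+ i).
have detD : \det D = \prod_(i < n) c ^+ i.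
  by rewrite det_diag; apply: eq_bigr => i _; rewrite mxE.
rewrite -detD expr2 -mulrA (mulrC (\det D)) -!det_mulmx; congr (\det _).
apply/matrixP => j k; rewrite mul_mx_diag mul_diag_mx !mxE exprD; ring.
Qed.

Theorem theorem1p2 (R : realType) (delta0 : R)
    (hdelta0 : is_smallest_root (fun delta : R => Ai (- delta)) delta0)
    (n : nat) (hn : (1 <= n)%N) (delta : R) (hdelta : delta < delta0) :
  hankel n delta != 0.
Proof.
have prod_neq0 (F : fieldType) (c : F) : c != 0 -> (\prod_(i < n) c ^+ i) ^+ 2 != 0.
  by move=> c0; rewrite expf_neq0//; apply/prodf_neq0 => i _; rewrite expf_neq0.
have -> : hankel n delta =
    \det (\matrix_(j < n, k < n) ('i%C ^+ (j + k) * (airy_moment (j + k) delta)%:C)).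
  by congr (\det _); apply/matrixP => j k; rewrite !mxE moment_airy.
rewrite (det_hankel_scale n 'i%C (fun k => (airy_moment k delta)%:C)).
rewrite mulf_neq0 ?prod_neq0 ?neq0Ci//.
have -> : \matrix_(j < n, k < n) (airy_moment (j + k) delta)%:C =
    map_mx (real_complex R) (\matrix_(j < n, k < n) airy_moment (j + k) delta).
  by apply/matrixP => j k; rewrite !mxE.
rewrite det_map_mx fmorph_eq0.
(* In the variable x = - delta the sign keeps each [y k.+1] the derivative of [y k], and the
   half-line delta < delta0 becomes x > - delta0. *)
pose y k (x : R) := (-1) ^+ k * airy_moment k (- x).
suff : \det (\matrix_(j < n, k < n) y (j + k)%N (- delta)) != 0.
  rewrite /y opprK (det_hankel_scale n (-1) (airy_moment ^~ delta)).
  by rewrite mulf_eq0 negb_or => /andP[].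
apply: (@airy_hankel_neq0 _ (- delta0)) => [k x _|x _|x dx||]; last by rewrite ltrN2.
- apply: (derE (derM (derC ((-1) ^+ k) x)
    (is_derive1_comp (derive_airy_moment k (- x)) (derN (derI x))))).
  by rewrite /y exprS; ring.
- by rewrite /y airy_moment2; ring.
(* A zero of [y 0] at [x] makes [- x] a root of delta |-> Ai(- delta), so minimality of [delta0]
   yields [x <= - delta0]. *)
- apply: contraTneq dx; rewrite /y expr0 mul1r => y0; rewrite -leNgt lerNr.
  by apply: hdelta0.2; rewrite Ai_airy_moment y0 mul0r.
have [M HM] := airy_moment_bounded (R := R).
by exists M, 0 => x x0; rewrite /y expr0 mul1r HM// oppr_le0 ltW.
Qed.
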